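(* Let $A$ be a nonempty set of positive integers and, for each positive integer $n$, let $K(n)=\sum_{i=1}^{n} 1_A(i)$. Then discarding a finite number of first terms does not change the asymptotic behavior of the sum $\sum_{i=1}^{n} K(i)/i$ as $n\to\infty$; that is, for every fixed positive integer $b$, $$\lim_{n\to\infty}\frac{\sum_{i=b+1}^{n} K(i)/i}{\sum_{i=1}^{n} K(i)/i}=1 .$$
   Context: Here $1_A$ is the indicator function of the set $A$: $1_A(i)=1$ if $i\in A$ and $1_A(i)=0$ otherwise. Thus $K(n)$ counts the elements of $A$ not exceeding $n$. The ratio is considered for all sufficiently large $n$, for which the denominator is nonzero. *)

(* Defs.v *)
From mathcomp Require Import all_boot all_order all_algebra.
From mathcomp Require Import all_classical all_reals all_analysis.
Import numFieldNormedType.Exports.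

Set Implicit Arguments.
Unset Strict Implicit.
Unset Printing Implicit Defensive.

Local Open Scope ring_scope.

Definition K (R : realType) (A : set nat) (n : nat) : R :=
  \sum_(1 <= i < n.+1) \1_A i.

(* The sum of K(i) / i over a <= i <= n; it is 0 when n < a. *)
Definition sumK (R : realType) (A : set nat) (a n : nat) : R :=
  \sum_(a <= i < n.+1) K R A i / i%:R.

(* Main.v *)
(** Discarding the first terms subtracts a constant from the denominator, so the
    ratio is [1 - sumK R A 1 b / sumK R A 1 n]. Once [a \in A] has been counted,
    [K i >= 1], hence [sumK R A 1 n] dominates a tail of the harmonic series and
    tends to infinity. *)
Require Import Defs.
From mathcomp Require Import all_boot all_order all_algebra.
From mathcomp Require Import all_classical all_reals all_analysis.
Import Order.TTheory GRing.Theory Num.Theory.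
Import numFieldNormedType.Exports.

Local Open Scope classical_set_scope.
Local Open Scope ring_scope.

(** Partial sums of nonnegative terms are nondecreasing, so failure to converge forces the limit
    [+oo]. *)
Lemma series_harmonic_cvgy (R : realType) : series (@harmonic R) @ \oo --> +oo.
Proof.
apply: nondecreasing_dvgn_lt (@dvg_harmonic R).
by apply: nondecreasing_series => n _ _; exact: harmonic_ge0.
Qed.

Lemma K_ge0 (R : realType) (A : set nat) (n : nat) : 0 <= K R A n.
Proof. by rewrite sumr_ge0. Qed.

(** The term at [i = a] alone contributes 1, and the other indicators are nonnegative. *)
Lemma K_ge1 (R : realType) (A : set nat) (a n : nat) :
  A a -> (0 < a <= n)%N -> 1 <= K R A n.
Proof.
move=> Aa /andP[a0 an].
rewrite /K (@big_cat_nat _ _ _ a) ?leqW//= (@big_ltn _ _ _ a) ?ltnS//=.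
rewrite indicE mem_set// addrCA lerDl.
by rewrite addr_ge0 ?sumr_ge0.
Qed.

Lemma sumK_ge0 (R : realType) (A : set nat) (a n : nat) : 0 <= sumK R A a n.
Proof. by rewrite sumr_ge0// => i _; rewrite divr_ge0 ?K_ge0. Qed.

Lemma sumK_split (R : realType) (A : set nat) (b n : nat) : (b <= n)%N ->
  sumK R A 1 n = sumK R A 1 b + sumK R A b.+1 n.
Proof. by move=> bn; rewrite /sumK (@big_cat_nat _ _ _ b.+1). Qed.

Lemma sumK_ge_harmonic (R : realType) (A : set nat) (a n : nat) :
  A a -> (0 < a <= n)%N ->
  series (@harmonic R) n - series (@harmonic R) a <= sumK R A 1 n.
Proof.
move=> Aa /andP[a0 an]; rewrite (sumK_split R A a n an) ler_wpDl ?sumK_ge0//.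
(* [harmonic i] is [1 / (i + 1)], so the index shift pairs it with [K R A (i + 1) / (i + 1)], whose
   numerator has already counted [a]. *)
rewrite sub_series_geq// /sumK big_add1 /=.
apply: ler_sum_nat => i /andP[ai _].
by rewrite ler_peMl ?invr_ge0// (@K_ge1 _ _ a)// a0 leqW.
Qed.

Lemma sumK_cvgy (R : realType) (A : set nat) (a : nat) :
  A a -> (0 < a)%N -> sumK R A 1 @ \oo --> +oo.
Proof.
move=> Aa a0; apply/cvgryPge => M.
have /cvgryPge/(_ (M + series (@harmonic R) a)) := @series_harmonic_cvgy R.
apply: filterS2 (nbhs_infty_ge a) => n /= an.
rewrite -lerBrDr => /le_trans; apply.
by apply: sumK_ge_harmonic; rewrite ?a0.
Qed.

Theorem mainTheorem1 (R : realType) (A : set nat)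
    (A_nonempty : A !=set0) (A_pos : forall i : nat, A i -> (0 < i)%N)
    (b : nat) (b_pos : (0 < b)%N) :
  (fun n : nat => sumK R A b.+1 n / sumK R A 1 n) @ \oo --> (1 : R).
Proof.
have [a Aa] := A_nonempty.
have Soo := @sumK_cvgy R _ _ Aa (A_pos _ Aa).
have S_gt0 : \forall n \near \oo, 0 < sumK R A 1 n.
  by move/cvgryPgt : Soo; apply.
have SV0 : (fun n => (sumK R A 1 n)^-1) @ \oo --> (0 : R).
  exact/(gtr0_cvgV0 S_gt0).
have ratio : (fun n => 1 - sumK R A 1 b * (sumK R A 1 n)^-1) @ \oo --> (1 : R).
  (* The limit 1 is rewritten as [1 - sumK R A 1 b * 0], to match the limit rules. *)
  rewrite -[X in _ --> X]subr0 -[X in _ - X](mulr0 (sumK R A 1 b)).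
  by apply: cvgB; [exact: cvg_cst | apply: cvgM => //; exact: cvg_cst].
(* Equality for large [n] suffices: splitting at [b] uses [b <= n], and writing 1 as a quotient uses
   a nonzero denominator. *)
apply: cvg_trans ratio; apply: near_eq_cvg.
near=> n.
have Sn0 : sumK R A 1 n != 0 by rewrite gt_eqF//; near: n.
have bn : (b <= n)%N by near: n; exact: nbhs_infty_ge.
by rewrite -[X in X - _](divff Sn0) -mulrBl {1}(sumK_split R A b n bn) addrAC subrr add0r.
Unshelve. all: by end_near.
Qed.
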